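(* Let $X$ and $Y$ be Hausdorff spaces and let $f:X\to Y$ be a continuous surjection that is both open and closed, where $X$ is a strongly monotonically monolithic space. Then $Y$ is a strongly monotonically monolithic space.
   Context: A family $\mathcal N$ of open subsets of a space $X$ is an *external base* of a subset $A\subset X$ in $X$ if for any $x\in A$ and any open $U$ with $x\in U$ there is $V\in\mathcal N$ with $x\in V\subset U$. A Tychonoff space $X$ is *strongly monotonically monolithic* if to every $A\subset X$ one can assign an external base $\mathcal O(A)$ of the closure $\overline{A}$ in $X$ such that: (a) $|\mathcal O(A)|\le\max\{|A|,\omega\}$; (b) if $A\subset B\subset X$ then $\mathcal O(A)\subset\mathcal O(B)$; (c) if $\alpha$ is an ordinal and $\{A_\beta:\beta<\alpha\}$ is a family of subsets of $X$ such that $\beta<\beta'<\alpha$ implies $A_\beta\subset A_{\beta'}$, then $\mathcal O(\bigcup_{\beta<\alpha}A_\beta)=\bigcup_{\beta<\alpha}\mathcal O(A_\beta)$. *)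

(* Defs.v *)
From mathcomp Require Import all_boot all_order all_algebra.
From mathcomp Require Import boolp classical_sets functions cardinality.
From mathcomp Require wochoice.
From mathcomp Require Import reals topology normedtype.

Set Implicit Arguments.
Unset Strict Implicit.
Unset Printing Implicit Defensive.

Local Open Scope classical_set_scope.
Local Open Scope card_scope.

(* The library's [completely_regular_space] is phrased with [uniform_separator],
   which by [uniform_separatorP] is separation by a continuous function into
   [0, 1], for every (equivalently, any one) [realType]. *)
Definition tychonoff_space (X : topologicalType) : Prop :=
  accessible_space X /\ completely_regular_space X.

Definition open_map (X Y : topologicalType) (f : X -> Y) : Prop :=
  forall U : set X, open U -> open (f @` U).

Definition closed_map (X Y : topologicalType) (f : X -> Y) : Prop :=
  forall F : set X, closed F -> closed (f @` F).

Definition external_base (X : topologicalType) (A : set X)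
    (N : set (set X)) : Prop :=
  N `<=` open /\
  forall (x : X) (U : set X), A x -> open U -> U x ->
    exists V : set X, [/\ N V, V x & V `<=` U].

(* [|B| <= max(|A|, omega)]: cardinals being totally ordered, lying below the
   maximum of two of them means lying below one of them. *)
Definition card_le_max_omega (T U : Type) (B : set T) (A : set U) : Prop :=
  B #<= A \/ B #<= [set: nat].

(* An ordinal is represented by an arbitrary, possibly empty, well-ordered type
   [I]; [wochoice.well_order] concerns the non-strict order, so that
   [b < b'] reads [b <> b' /\ le b b']. *)
Definition strongly_monotonically_monolithic (X : topologicalType) : Prop :=
  tychonoff_space X /\
  exists O : set X -> set (set X),
    [/\ forall A : set X, external_base (closure A) (O A),
        forall A : set X, card_le_max_omega (O A) A,
        forall A B : set X, A `<=` B -> O A `<=` O B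
      & forall (I : Type) (le : rel I) (A : I -> set X),
          wochoice.well_order le ->
          (forall b b' : I, b <> b' -> le b b' -> A b `<=` A b') ->
          O (\bigcup_b A b) = \bigcup_b O (A b)].

(* Main.v *)
Require Import Defs.
From mathcomp Require Import all_boot all_order all_algebra.
From mathcomp Require Import boolp classical_sets functions cardinality.
From mathcomp Require Import reals topology normedtype.
From mathcomp Require Import Rstruct.
From Stdlib Require Rdefinitions.

(** Transport the base operator through a section [s] of [f]: put
    [O_Y(B) = {f(V) : V in O_X(s(B))}]. Since [f] is closed, [f] maps the closure
    of [s(B)] onto a set containing the closure of [B], and since [f] is open the
    sets [f(V)] are open; monotonicity and continuity in [B] are inherited because
    images commute with unions. Complete regularity of [Y] comes from the fact
    that the fibrewise infimum of a continuous function bounded below on the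
    fibres of an open and closed map is continuous. *)

Import Order.TTheory GRing.Theory Num.Theory.
Import numFieldNormedType.Exports.

Local Open Scope classical_set_scope.
Local Open Scope ring_scope.

Definition fiber_inf {R : realType} {X Y : Type} (f : X -> Y) (g : X -> R)
    (y : Y) : R :=
  inf (g @` (f @^-1` [set y])).

(** Openness gives upper semicontinuity: the fibres meeting [g < c] lie over an open set. Closedness
    gives lower semicontinuity: the fibres meeting [g <= c] lie over a closed set, off which the
    infimum is at least [c]. *)
Lemma fiber_inf_continuous (R : realType) (X Y : topologicalType) (f : X -> Y)
    (g : X -> R) :
  open_map f -> closed_map f -> continuous g ->
  (forall y, has_inf (g @` (f @^-1` [set y]))) ->
  continuous (fiber_inf f g).
Proof.
move=> f_open f_closed g_cont infg y; apply/cvgrPdist_le => e e0.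
have upper : nbhs y (f @` (g @^-1` [set r | r < fiber_inf f g y + e])).
  apply: open_nbhs_nbhs; split.
    by apply: f_open; apply: open_comp => [x _|]; [exact: g_cont|exact: open_lt].
  by have [_ [x /= fxy <-] gx] := inf_adherent e0 (infg y); exists x.
have lower : nbhs y (~` (f @` (g @^-1` [set r | r <= fiber_inf f g y - e]))).
  apply: open_nbhs_nbhs; split.
    apply: closed_openC; apply: f_closed.
    by apply: preimage_closed => [x _|]; [exact: g_cont|exact: closed_le].
  move=> [x /= gx fxy].
  have : fiber_inf f g y <= g x by apply: ge_inf; [exact: (infg y).2|exists x].
  by move=> /le_trans/(_ gx); rewrite lerBrDr gerDl leNgt e0.
near=> z.
rewrite distrC ler_distl; apply/andP; split.
  apply: lb_le_inf; first exact: (infg z).1.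
  move=> _ [x /= fxz <-]; rewrite leNgt; apply/negP => gx.
  have : (~` (f @` (g @^-1` [set r | r <= fiber_inf f g y - e]))) z by near: z.
  by apply; exists x => //=; exact: ltW.
have [x /= gx fxz] :
  (f @` (g @^-1` [set r | r < fiber_inf f g y + e])) z by near: z.
by apply: le_trans (ltW gx); apply: ge_inf; [exact: (infg z).2|exists x].
Unshelve. all: by end_near. Qed.

(** A function [g] into [0, 1] separating one point over [y] from the preimage of [B] suffices: its
    fibrewise infimum separates [y] from [B]. *)
Lemma completely_regular_open_closed_image (X Y : topologicalType)
    (f : X -> Y) :
  continuous f -> set_surj [set: X] [set: Y] f -> open_map f -> closed_map f ->
  completely_regular_space X -> completely_regular_space Y.
Proof.
move=> f_cont f_surj f_open f_closed crX y B clB nBy.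
have [x _ fxy] := f_surj y I.
have clfB : closed (f @^-1` B) by apply: preimage_closed => // ? _; exact: f_cont.
have nfBx : ~ (f @^-1` B) x by rewrite /= fxy.
have /(@uniform_separatorP _ Rdefinitions.R)[g [g_cont g01 gx gB]] :=
  crX x _ clfB nfBx.
have g_itv t : 0 <= g t <= 1.
  by have := g01 (g t); rewrite /= in_itv; apply; exists t.
have g_ge0 t : 0 <= g t by have /andP[] := g_itv t.
have g_le1 t : g t <= 1 by have /andP[] := g_itv t.
have infg z : has_inf (g @` (f @^-1` [set z])).
  split; last by exists 0 => _ [t _ <-].
  by have [t _ ftz] := f_surj z I; exists (g t), t.
have fiber_inf_ge0 z : 0 <= fiber_inf f g z.
  by apply: lb_le_inf; [exact: (infg z).1|move=> _ [t _ <-]].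
apply/(@uniform_separatorP _ Rdefinitions.R); exists (fiber_inf f g); split.
- exact: fiber_inf_continuous.
- move=> _ [z _ <-]; rewrite /= in_itv /= fiber_inf_ge0 /=.
  have [t _ ftz] := f_surj z I.
  by apply: le_trans (g_le1 t); apply: ge_inf; [exact: (infg z).2|exists t].
- move=> _ [_ -> <-]; apply/eqP; rewrite eq_le fiber_inf_ge0 andbT.
  have <- : g x = 0 by apply: gx; exists x.
  by apply: ge_inf; [exact: (infg y).2|exists x].
- move=> _ [z Bz <-]; rewrite /fiber_inf.
  (* Surjectivity matters here: an empty fibre would give [inf] its default value 0 instead of 1. *)
  suff -> : g @` (f @^-1` [set z]) = [set 1] by rewrite inf1.
  have g1 t : f t = z -> g t = 1.
    by move=> ftz; apply: gB; exists t; rewrite //= ftz.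
  apply/seteqP; split=> [_ [t /= /g1 gt1 <-] //|_ ->].
  by have [t _ ftz] := f_surj z I; exists t => //; exact: g1.
Qed.

Lemma external_base_open_closed_image (X Y : topologicalType) (f : X -> Y)
    (A : set X) (N : set (set X)) :
  continuous f -> open_map f -> closed_map f ->
  external_base (closure A) N ->
  external_base (closure (f @` A)) ((fun V => f @` V) @` N).
Proof.
move=> f_cont f_open f_closed [N_open N_base]; split.
  by move=> _ [V NV <-]; apply: f_open; exact: N_open.
move=> y U cly oU Uy.
(* The image of [closure A] is closed and contains the image of [A], so [y] lifts to a point of
   [closure A]. *)
have [x clx fxy] : (f @` closure A) y.
  have clf := f_closed _ (@closed_closure _ A).
  rewrite ((closure_id _).1 clf).
  by move: cly; apply: closure_subset; apply: image_subset; exact: subset_closure.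
have oV : open (f @^-1` U) by apply: open_comp => // ? _; exact: f_cont.
have [|V [NV Vx VU]] := N_base x _ clx oV; first by rewrite /= fxy.
exists (f @` V); split; [by exists V|by exists x|].
by move=> _ [t /VU Ut <-].
Qed.

Theorem theorem5p10 (X Y : topologicalType) (f : X -> Y)
    (hX : hausdorff_space X) (hY : hausdorff_space Y)
    (f_cont : continuous f) (f_surj : set_surj [set: X] [set: Y] f)
    (f_open : open_map f) (f_closed : closed_map f)
    (X_smm : strongly_monotonically_monolithic X) :
  strongly_monotonically_monolithic Y.
Proof.
have [[_ crX] [O [O_base O_card O_mono O_cup]]] := X_smm.
split.
  split; first exact: hausdorff_accessible.
  exact: completely_regular_open_closed_image crX.
have /choice[s sK] : forall y, exists x, f x = y.
  by move=> y; have [x _ fxy] := f_surj y I; exists x.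
exists (fun B => (fun V => f @` V) @` O (s @` B)); split.
(* As [s] is a right inverse of [f], [B] is the image of [s(B)], whose external base can be pushed
   forward. *)
- move=> B; have {1}-> : B = f @` (s @` B).
    by rewrite image_comp -[LHS]image_id; apply: eq_imagel => y _ /=; rewrite sK.
  exact: external_base_open_closed_image.
(* Two images, neither raising cardinality: [s(B)] of [B], and the new base of [O (s(B))]. *)
- move=> B; case: (O_card (s @` B)) => le_O; [left|right].
    apply: card_le_trans (card_image_le s B).
    by apply: card_le_trans le_O; exact: card_image_le.
  by apply: card_le_trans le_O; exact: card_image_le.
- by move=> A B AB; apply: image_subset; apply: O_mono; exact: image_subset.
(* Unions commute first with the image under [s], then with [O] along the chain of the [s(A b)],
   then with the image under [f]. *)
- move=> I le A le_wo A_mono; rewrite image_bigcup (O_cup I le) ?image_bigcup//.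
  by move=> b b' bb' lebb'; apply: image_subset; exact: A_mono.
Qed.
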